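(* Let $K$ be a field, $S=K[x_1,\ldots,x_n]$, and let $I\subset S$ be a monomial ideal. If $I$ is componentwise polymatroidal, then $I$ satisfies the non-pure exchange property.
   Context: For a monomial ideal $I$, $G(I)$ denotes its unique minimal set of monomial generators, and $\deg_{x_i}(u)$ is the exponent of $x_i$ in the monomial $u$. A monomial ideal $I$ is polymatroidal if it is generated in a single degree (all elements of $G(I)$ have the same degree) and, for all $u,v\in G(I)$ and every $i$ with $\deg_{x_i}(u)>\deg_{x_i}(v)$, there exists $j$ with $\deg_{x_j}(u)<\deg_{x_j}(v)$ such that $x_j(u/x_i)\in I$ (the zero ideal satisfies this vacuously). For a monomial ideal $I$, $I_{\langle j\rangle}$ denotes the ideal generated by all monomials of degree $j$ in $I$. $I$ is componentwise polymatroidal if $I_{\langle j\rangle}$ is polymatroidal for all $j$. A monomial ideal $I$ satisfies the non-pure exchange property if for all $u,v\in G(I)$ with $\deg(u)\leq\deg(v)$ and for all $i$ such that $\deg_{x_i}(v)>\deg_{x_i}(u)$, there exists $j$ such that $\deg_{x_j}(v)<\deg_{x_j}(u)$ and $x_j(v/x_i)\in I$. *)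

(* Defs.v *)
From mathcomp Require Import all_boot all_algebra.
From mathcomp Require Export mpoly.

Set Implicit Arguments.
Unset Strict Implicit.
Unset Printing Implicit Defensive.

Import GRing.Theory.
Local Open Scope ring_scope.

(* The ideals of ring_quotient.v are decidable and proper; here the unit ideal
   is allowed, and ideals are arbitrary (Prop-valued) subsets. *)
Definition is_ideal (R : comNzRingType) (I : R -> Prop) : Prop :=
  [/\ I 0,
      forall p q, I p -> I q -> I (p + q)
    & forall r p, I p -> I (r * p)].

Section MonomialIdeals.

Variables (n : nat) (K : fieldType).

Implicit Types (I : {mpoly K[n]} -> Prop) (A B : 'X_{1..n} -> Prop).
Implicit Types (u v : 'X_{1..n}).

Definition monomial_span A : {mpoly K[n]} -> Prop := fun p =>
  forall J : {mpoly K[n]} -> Prop,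
    is_ideal J -> (forall m, A m -> J 'X_[m]) -> J p.

Definition generates A I : Prop := forall p, I p <-> monomial_span A p.

Definition monomial_ideal I : Prop := exists A, generates A I.

Definition minimal_generators I A : Prop :=
  generates A I /\
  forall B, (forall m, B m -> A m) -> generates B I -> forall m, A m -> B m.

(* For a monomial ideal I there is, up to extensionality, exactly one A with
   minimal_generators I A,
   so that G I is this A. *)
Definition G I : 'X_{1..n} -> Prop := fun u =>
  exists2 A, minimal_generators I A & A u.

(* In the exchange conditions, the truncated subtraction of U_(i) is an exact
   division by x_i, since the exponent of x_i is positive there. *)
Definition polymatroidal I : Prop :=
  [/\ monomial_ideal I,
      forall u v, G I u -> G I v -> mdeg u = mdeg v
    & forall u v, G I u -> G I v -> forall i : 'I_n, (v i < u i)%N ->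
        exists2 j : 'I_n, (u j < v j)%N & I 'X_[u - U_(i) + U_(j)]].

Definition component I (d : nat) : {mpoly K[n]} -> Prop :=
  monomial_span (fun m => mdeg m = d /\ I 'X_[m]).

Definition componentwise_polymatroidal I : Prop :=
  forall d : nat, polymatroidal (component I d).

Definition nonpure_exchange I : Prop :=
  forall u v, G I u -> G I v -> (mdeg u <= mdeg v)%N ->
  forall i : 'I_n, (u i < v i)%N ->
    exists2 j : 'I_n, (v j < u j)%N & I 'X_[v - U_(i) + U_(j)].

End MonomialIdeals.

(* Main.v *)
Require Import Defs.
From mathcomp Require Import all_boot all_algebra.

(** Let u and v be minimal generators of I, of degrees a <= b, with
    v_i > u_i.  The exchange property of the component of degree b cannot be
    applied to the pair (v, u), since u has the wrong degree; the idea is to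
    replace u by a multiple u w of degree b which is still so close to u that
    every exchange between v and u w is already an exchange between v and u.
    This is ensured when u w divides lcm(u, v) / x_i: the exponent of x_i in u w
    is then below v_i, so an exchange removing x_i from v is possible, and an
    exponent of u w that exceeds v_j can only come from u, i.e. u_j > v_j.

    Such a multiple of degree b exists as soon as lcm(u, v) / x_i has degree at
    least b, i.e. as soon as lcm(u, v) <> v.  This is where minimality enters:
    u divides v only if u = v (lemma [G_minimal]), which v_i > u_i excludes.
    Finally, u w and v are minimal generators of the component of degree b,
    because so are all monomials of I of that degree (lemma [G_component]).

    Both facts on generators reduce to the description of the monomials in an
    ideal spanned by monomials: they are the multiples of the spanning
    monomials (lemma [monomial_span_dvd]). *)

Set Implicit Arguments.
Unset Strict Implicit.
Unset Printing Implicit Defensive.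

Import GRing.Theory.
Local Open Scope ring_scope.

(** * Divisibility of monomials *)

Section Multinomials.

Variable n : nat.
Implicit Types u v c m : 'X_{1..n}.

Lemma mdeg_le u v : (u <= v)%MM -> (mdeg u <= mdeg v)%N.
Proof. by move=> le_uv; rewrite -(submK le_uv) mdegD leq_addl. Qed.

Lemma lepm_anti u v : (u <= v)%MM -> (v <= u)%MM -> u = v.
Proof.
move=> /mnm_lepP le_uv /mnm_lepP le_vu; apply/mnmP => i.
by apply/eqP; rewrite eqn_leq le_uv le_vu.
Qed.

Lemma lepm_mdeg_eq u v : (u <= v)%MM -> mdeg u = mdeg v -> u = v.
Proof.
move=> le_uv; rewrite -{1 2}(submK le_uv) mdegD => /eqP.
by rewrite -{1}[mdeg u]add0n eqn_add2r eq_sym mdeg_eq0 => /eqP ->; rewrite add0m.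
Qed.

(** The divisibility order has no gaps in degree: one variable is added at a
    time, which is possible below [c] until the degree of [c] is reached. *)
Lemma lepm_mdeg_between u c d :
    (u <= c)%MM -> (mdeg u <= d <= mdeg c)%N ->
  exists m, [/\ (u <= m)%MM, (m <= c)%MM & mdeg m = d].
Proof.
move=> le_uc /andP[/subnKC <-]; elim: (d - mdeg u)%N => {d} [|k IHk].
  by exists u; rewrite addn0 lepm_refl.
rewrite addnS => lt_kc; have [m [le_um le_mc deg_m]] := IHk (ltnW lt_kc).
have /forallPn[j] : ~~ (c <= m)%MM.
  by apply/negP => /mdeg_le; rewrite deg_m leqNgt lt_kc.
rewrite -ltnNge => lt_mcj; exists (m + U_(j))%MM; split.
- exact: lepm_trans le_um (lem_addr _ _).
- apply/mnm_lepP => l; rewrite mnmDE mnm1E.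
  case: eqP => [<-|_]; first by rewrite addn1.
  by rewrite addn0; apply/mnm_lepP.
- by rewrite mdegD mdeg1 deg_m addn1.
Qed.

Lemma mdeg_mlcm_gt u v : ~~ (u <= v)%MM -> (mdeg v < mdeg (mlcm u v))%N.
Proof.
move=> nle_uv; rewrite mlcmC mlcmE mdegD -[X in (X < _)%N]addn0 ltn_add2l.
rewrite lt0n mdeg_eq0; apply: contra nle_uv => /eqP/mnmP uv0.
by apply/mnm_lepP => i; rewrite -subn_eq0 -mnmBE uv0 mnm0E.
Qed.

(** Any multiple of [u] dividing [lcm(u, v) / x_i] exceeds [v] only in variables
    where [u] does, and is below [v] in [x_i]; the lemma finds one with the
    degree of [v]. *)
Lemma mdeg_lift u v (i : 'I_n) :
    ~~ (u <= v)%MM -> (mdeg u <= mdeg v)%N -> (u i < v i)%N ->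
  exists m, [/\ (u <= m)%MM, mdeg m = mdeg v, (m i < v i)%N
              & forall j, (v j < m j)%N -> (v j < u j)%N].
Proof.
move=> nle_uv le_deg lt_i; pose c := (mlcm u v - U_(i))%MM.
have cE j : c j = (maxn (u j) (v j) - (i == j))%N by rewrite mnmBE mnmE mnm1E.
have le_uc : (u <= c)%MM.
  apply/mnm_lepP => j; rewrite cE; case: eqP => [<-|_].
    by rewrite (maxn_idPr (ltnW lt_i)) leq_subRL ?(leq_ltn_trans _ lt_i).
  by rewrite subn0 leq_maxl.
have deg_c : (mdeg v <= mdeg c)%N.
  have := mdeg_mlcm_gt nle_uv; rewrite -[mlcm u v](@submK _ U_(i)%MM).
    by rewrite mdegD mdeg1 addn1 ltnS.
  rewrite lep1mP mnmE -lt0n; apply: leq_trans (leq_maxr _ _).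
  exact: leq_ltn_trans lt_i.
have [|m [le_um /mnm_lepP le_mc deg_m]] := lepm_mdeg_between le_uc (d := mdeg v).
  by rewrite le_deg.
exists m; split => // [|j lt_j].
  apply: leq_ltn_trans (le_mc i) _; rewrite cE eqxx (maxn_idPr (ltnW lt_i)).
  by rewrite ltn_subrL /= (leq_ltn_trans _ lt_i).
have: (v j < maxn (u j) (v j))%N.
  by apply: leq_trans lt_j (leq_trans (le_mc j) _); rewrite cE leq_subr.
by rewrite leq_max ltnn orbF.
Qed.

End Multinomials.

(** * Ideals spanned by monomials *)

Section MonomialSpan.

Variables (n : nat) (K : fieldType).
Implicit Types (I : {mpoly K[n]} -> Prop) (A B : 'X_{1..n} -> Prop).
Implicit Types (u v m : 'X_{1..n}) (d : nat).

Lemma monomial_span_ideal A : is_ideal (@monomial_span n K A).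
Proof.
split=> [J [] // | p q Ap Aq J idJ AJ | r p Ap J idJ AJ]; have [_ addJ mulJ] := idJ.
- by apply: addJ; [apply: Ap | apply: Aq].
- by apply: mulJ; apply: Ap.
Qed.

Lemma monomial_span_incl A m : A m -> @monomial_span n K A 'X_[m].
Proof. by move=> Am J _; apply. Qed.

Lemma ideal_mpolyX_le I u v : is_ideal I -> I 'X_[u] -> (u <= v)%MM -> I 'X_[v].
Proof.
by case=> _ _ mulI Iu le_uv; rewrite -(submK le_uv) mpolyXD; apply: mulI.
Qed.

(** The polynomials all of whose monomials are multiples of elements of [A] form
    an ideal containing [A], hence the whole span of [A]. *)
Lemma monomial_span_dvd A m :
  @monomial_span n K A 'X_[m] -> exists2 a, A a & (a <= m)%MM.
Proof.
pose J (p : {mpoly K[n]}) :=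
  forall m, m \in msupp p -> exists2 a, A a & (a <= m)%MM.
move=> /(_ J) Jm; suff: J 'X_[m] by apply; rewrite msuppX mem_seq1.
apply: Jm => [|a Aa m']; last first.
  by rewrite msuppX mem_seq1 => /eqP ->; exists a; rewrite ?lepm_refl.
split=> [m'|p q Jp Jq m' /msuppD_le|r p Jp m' /msuppM_le].
- by rewrite msupp0.
- by rewrite mem_cat => /orP[/Jp|/Jq].
- case/allpairsP=> -[m1 m2] [_ /Jp[a Aa le_a] ->]; exists a => //.
  exact: lepm_trans le_a (lem_addl _ _).
Qed.

Lemma monomial_ideal_is_ideal I : monomial_ideal I -> is_ideal I.
Proof.
case=> A genA; have [span0 spanD spanM] := monomial_span_ideal A; split.
- exact/genA.
- by move=> p q /genA Ap /genA Aq; apply/genA; exact: spanD.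
- by move=> r p /genA Ap; apply/genA; exact: spanM.
Qed.

Lemma G_mem I u : G I u -> I 'X_[u].
Proof. by case=> A [genA _] Au; apply/genA; exact: monomial_span_incl. Qed.

(** Some generator [a] divides [v].  If [a] were not [u], then [u] would be a
    proper multiple of [a], and would be redundant in the generating set. *)
Lemma G_minimal I u v : G I u -> I 'X_[v] -> (v <= u)%MM -> v = u.
Proof.
case=> A [genA minA] Au /genA/monomial_span_dvd[a Aa le_av] le_vu.
have le_au := lepm_trans le_av le_vu.
suff au : a = u by apply: lepm_anti => //; rewrite -au.
apply/eqP/negP => /negP ne_au; pose B m := A m /\ m <> u.
have Ba : B a by split=> //; apply/eqP.
suff /(minA B) : generates B I by case/(_ (fun m => @proj1 _ _) u Au).
move=> p; split=> [/genA Ap J idJ BJ | Bp].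
- apply: Ap => // m Am; have [->|/eqP ne_mu] := eqVneq m u; last exact: BJ.
  exact: ideal_mpolyX_le idJ (BJ a Ba) le_au.
- by apply/genA => J idJ AJ; apply: Bp => // m [/AJ].
Qed.

Lemma component_sub I d p : is_ideal I -> component I d p -> I p.
Proof. by move=> idI; apply=> // m []. Qed.

(** Distinct monomials of equal degree do not divide each other, so that none of
    the monomials spanning a component is redundant. *)
Lemma G_component I d m : mdeg m = d -> I 'X_[m] -> G (component I d) m.
Proof.
move=> deg_m Im; exists (fun m => mdeg m = d /\ I 'X_[m]) => //.
split=> // B subB genB m' Am'.
have /genB/monomial_span_dvd[b Bb le_b] : component I d 'X_[m'].
  exact: monomial_span_incl.
by rewrite -(lepm_mdeg_eq le_b) //; have [-> _] := subB b Bb; case: Am'.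
Qed.

End MonomialSpan.

(** * The exchange property *)

Theorem proposition3p5 (K : fieldType) (n : nat) (I : {mpoly K[n]} -> Prop) :
  monomial_ideal I ->
  componentwise_polymatroidal I ->
  nonpure_exchange I.
Proof.
move=> /monomial_ideal_is_ideal idI polyI u v Gu Gv le_deg i lt_i.
have nle_uv : ~~ (u <= v)%MM.
  by apply/negP => /(G_minimal Gv (G_mem Gu)) uv; rewrite uv ltnn in lt_i.
have [m [le_um deg_m lt_mi lt_vu]] := mdeg_lift nle_uv le_deg lt_i.
have Im := ideal_mpolyX_le idI (G_mem Gu) le_um.
have [_ _ exch] := polyI (mdeg v).
have [j lt_j Ij] :=
  exch v m (G_component erefl (G_mem Gv)) (G_component deg_m Im) i lt_mi.
by exists j; [apply: lt_vu | apply: component_sub Ij].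
Qed.
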